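(* Let $\Theta = \{\theta_1, \ldots, \theta_n\}$ be a set of positive rational numbers, and suppose $\Theta \subset [a_1; b_1] \cup \ldots \cup [a_m; b_m]$ with $0 < a_i \leq b_i$. Let $F$ be a non-zero function defined by \[ F(x) = \sum_{\theta \in \Theta} a_{\theta}\cos(2\pi \theta x) + b_{\theta}\sin(2\pi \theta x), \quad a_\theta, b_\theta \in \mathbb{R}. \] Then \[ \min(\rho_+(F), \rho_-(F)) \geq \frac{1}{1 + \frac{b_1}{a_1}} \cdots \frac{1}{1 + \frac{b_m}{a_m}}. \]
   Context: Such an $F$ is continuous and periodic. For a continuous periodic function $F\colon \mathbb{R} \to \mathbb{R}$ with period $P > 0$, $\rho_+(F) = \lambda(\{x \in [0,P] : F(x) > 0\})/P$ and $\rho_-(F) = \lambda(\{x \in [0,P] : F(x) < 0\})/P$, where $\lambda$ is Lebesgue measure on $\mathbb{R}$ (these do not depend on the choice of period). *)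

(* Defs.v *)
From HB Require Import structures.
From mathcomp Require Import all_boot all_order all_algebra.
From mathcomp Require Import all_classical all_reals all_analysis.
Set Implicit Arguments. Unset Strict Implicit. Unset Printing Implicit Defensive.
Import Order.TTheory GRing.Theory Num.Theory.
Local Open Scope classical_set_scope.
Local Open Scope ring_scope.

Definition trig_poly (R : realType) (n : nat) (th : 'I_n -> rat)
  (ca cb : 'I_n -> R) (x : R) : R :=
  \sum_(k < n) (ca k * cos (2 * pi * ratr (th k) * x)
               + cb k * sin (2 * pi * ratr (th k) * x)).

(* rho_+(F) and rho_-(F) computed with respect to a period P > 0 of F *)
Definition rho_plus (R : realType) (F : R -> R) (P : R) : R :=
  fine ((@lebesgue_measure R) [set x : R | 0 <= x <= P /\ 0 < F x]) / P.

Definition rho_minus (R : realType) (F : R -> R) (P : R) : R :=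
  fine ((@lebesgue_measure R) [set x : R | 0 <= x <= P /\ F x < 0]) / P.

(* Main.v *)
Require Import Defs.
From HB Require Import structures.
From mathcomp Require Import all_boot all_order all_algebra.
From mathcomp Require Import all_classical all_reals all_analysis.
From mathcomp Require Import measurable_realfun complex ring lra zify.
Import Order.TTheory GRing.Theory Num.Theory.
Local Open Scope ring_scope.
Local Open Scope complex_scope.

(** After rescaling x, the frequencies are integers p with p \in [A_i, B_i] for
some i, where A_i / (A_i + B_i) >= a_i / (a_i + b_i). Put q_i = A_i + B_i and
sample F at the points x + \sum_i j_i / q_i with 0 <= j_i < q_i. The sampled
function u on \prod_i Z/q_i has no frequency congruent to a vector d with
|d_i| < A_i for all i, so \sum_j u(j) |Q(j)|^2 = 0 for every Q in the span of
the characters with 0 <= k_i < A_i. If u had fewer than \prod_i A_i positive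
values, some nonzero Q would vanish at all of them, and then u |Q|^2 <= 0 would
force Q = 0 wherever u does not vanish. For all but countably many x, u vanishes
nowhere, so at least \prod_i A_i of the \prod_i q_i samples are positive;
averaging over x in a period gives the bound. *)

(** * Linear algebra: positive values on an isotropic span *)

(** This is the inertia bound for the diagonal Hermitian form with entries [u]: a totally isotropic
    subspace has dimension at most the number of positive entries. Orthogonality makes the [phi k]
    independent, so their span has dimension [#|A|]. *)
Lemma isotropic_card (R : rcfType) (I K : finType) (J : {set I}) (A : {set K})
    (u : I -> R) (phi : K -> I -> R[i]) (N : R[i]) :
    N != 0 ->
    {in J, forall j, u j != 0} ->
    {in A &, forall k l, \sum_(j in J) (u j)%:C * (phi k j * (phi l j)^*%C) = 0} ->
    {in A &, forall k l,
      \sum_(j in J) phi k j * (phi l j)^*%C = if k == l then N else 0} ->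
  (#|A| <= #|[set j in J | (0 < u j)%R]|)%N.
Proof.
move=> N0 u0 iso orth; rewrite leqNgt; apply/negP => ltTA.
set T := [set j in J | 0 < u j] in ltTA *.
pose M : 'M[R[i]]_(#|A|, #|T|) := \matrix_(k, j) phi (enum_val k) (enum_val j).
(* The rank of [M] is at most [#|T| < #|A|], so its rows are dependent; a relation [c] between them
   gives a combination [Q] vanishing on [T]. *)
have : kermx M != 0.
  rewrite -mxrank_eq0 mxrank_ker subn_eq0 -ltnNge.
  exact: leq_ltn_trans (rank_leq_col _) ltTA.
case/rowV0Pn => c /sub_kermxP cM c0.
pose Q j := \sum_k c 0 k * phi (enum_val k) j.
have QT j : j \in T -> Q j = 0.
  move=> jT; have /(congr1 (fun B : 'M[R[i]]_(_, _) => B 0 (enum_rank_in jT j))) := cM.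
  rewrite !mxE => cM0; rewrite -[RHS]cM0; apply: eq_bigr => k _.
  by rewrite !mxE enum_rankK_in.
have QQ (v : I -> R[i]) : \sum_(j in J) v j * (Q j * (Q j)^*%C) =
    \sum_k \sum_l c 0 k * (c 0 l)^*%C *
      \sum_(j in J) v j * (phi (enum_val k) j * (phi (enum_val l) j)^*%C).
  under eq_bigr => j _.
    rewrite /Q rmorph_sum mulr_suml mulr_sumr.
    under eq_bigr do rewrite mulr_sumr mulr_sumr.
    over.
  rewrite exchange_big; apply: eq_bigr => k _.
  rewrite exchange_big; apply: eq_bigr => l _.
  rewrite mulr_sumr; apply: eq_bigr => j _.
  by rewrite rmorphM /=; ring.
have sum0 : \sum_(j in J) - (u j)%:C * (Q j * (Q j)^*%C) = 0.
  under eq_bigr do rewrite mulNr.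
  rewrite sumrN QQ big1 ?oppr0 // => k _; rewrite big1 // => l _.
  by rewrite iso ?mulr0 ?enum_valP.
(* Off [T] the values of [u] are negative, so every term of [sum0] is nonnegative and hence zero. *)
have Q0 j : j \in J -> Q j = 0.
  move=> jJ; have [/QT//|jT] := boolP (j \in T).
  have ult0 : u j < 0.
    move: jT; rewrite inE jJ /= -leNgt le_eqVlt => /orP[/eqP uj|//].
    by move: (u0 _ jJ); rewrite uj eqxx.
  have ge0 i : i \in J -> 0 <= - (u i)%:C * (Q i * (Q i)^*%C).
    move=> iJ; have [/QT->|iT] := boolP (i \in T); first by rewrite mul0r mulr0.
    rewrite mulr_ge0 ?mulcJ_ge0 // -rmorphN /= ler0c oppr_ge0.
    by move: iT; rewrite inE iJ /= -leNgt.
  move: (psumr_eq0P ge0 sum0 jJ) => /eqP; rewrite !mulf_eq0 oppr_eq0 conjc_eq0.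
  rewrite orbb => /orP[|/eqP//]; rewrite (inj_eq (@complexI _) (u j) 0).
  by rewrite (lt_eqF ult0).
case/negP: c0; apply/eqP/rowP => k; rewrite mxE.
(* Pairing [Q] with [phi k] isolates [c 0 k * N], which contradicts [c != 0]. *)
have : \sum_(j in J) Q j * (phi (enum_val k) j)^*%C = 0.
  by rewrite big1 // => j /Q0 ->; rewrite mul0r.
under eq_bigr do rewrite mulr_suml.
rewrite exchange_big /=.
under eq_bigr => l _.
  under eq_bigr do rewrite -mulrA.
  rewrite -mulr_sumr orth ?enum_valP// (inj_eq enum_val_inj).
  over.
rewrite (bigD1 k) //= eqxx big1 => [|l /negbTE->]; last by rewrite mulr0.
by rewrite addr0 => /eqP; rewrite mulf_eq0 (negbTE N0) orbF => /eqP.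
Qed.

(** * The complex exponential and vanishing character sums *)

Definition cis {R : realType} (t : R) : R[i] := cos t +i* sin t.

Lemma cisD (R : realType) (s t : R) : cis (s + t) = cis s * cis t.
Proof. by rewrite /cis cosD sinD; simpc; congr (_ +i* _); ring. Qed.

Lemma cis0 (R : realType) : cis (0 : R) = 1.
Proof. by rewrite /cis cos0 sin0. Qed.

Lemma conjc_cis (R : realType) (t : R) : (cis t)^*%C = cis (- t).
Proof. by rewrite /cis cosN sinN. Qed.

Lemma cis_sum (R : realType) (I : Type) (r : seq I) (f : I -> R) :
  cis (\sum_(i <- r) f i) = \prod_(i <- r) cis (f i).
Proof. by apply: (big_morph (@cis R)); [exact: cisD | exact: cis0]. Qed.

Lemma cisMn (R : realType) (t : R) (n : nat) : cis (t *+ n) = cis t ^+ n.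
Proof.
by elim: n => [|n IH]; rewrite ?mulr0n ?cis0 // mulrS cisD IH exprS.
Qed.

(** If [cos t = 1], the half-angle formula forces [sin (t / 2) = 0], although [t / 2] lies strictly
    between 0 and [pi]. *)
Lemma cis_neq1 (R : realType) (t : R) : 0 < t < 2 * pi -> cis t != 1.
Proof.
move=> /andP[t0 t2]; apply/eqP => -[ct st].
have : 0 < sin (t / 2) by apply: sin_gt0_pi; apply/andP; split; lra.
have := cos_mulr2n (t / 2); rewrite -(mulr_natr (t / 2)) divfK ?pnatr_eq0// ct.
rewrite cos2sin2 => H; have /eqP : sin (t / 2) ^+ 2 = 0 by lra.
by rewrite sqrf_eq0 => /eqP ->; rewrite ltxx.
Qed.

Lemma cis_int (R : realType) (d : int) : cis (2 * pi * d%:~R : R) = 1.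
Proof.
have H n : cis (2 * pi * n%:R : R) = 1.
  by rewrite mulr_natr cisMn /cis mulr_natl cos2pi sin2pi expr1n.
case: d => n; first exact: H.
by rewrite NegzE rmorphN mulrN -conjc_cis H conjc1.
Qed.

(** A geometric sum whose ratio [w] is a [q]-th root of unity different from 1. *)
Lemma sum_cis0 (R : realType) (q : nat) (d : int) : (0 < `|d| < q)%N ->
  \sum_(j < q) cis (2 * pi * (d%:~R / q%:R * j%:R) : R) = 0.
Proof.
move=> /andP[d0 dq].
pose w := cis (2 * pi * (d%:~R / q%:R) : R).
have q0 : (q%:R : R) != 0 by rewrite pnatr_eq0 -lt0n (leq_trans _ dq).
have qgt0 : (0 < q%:R :> R) by rewrite ltr0n (leq_trans _ dq).
have wq : w ^+ q = 1.
  rewrite -cisMn -[LHS]/(cis _) -[RHS](cis_int R d); congr cis.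
  by rewrite -[LHS]mulr_natr; field.
have w1 : w != 1.
  have H n : (0 < n < q)%N -> cis (2 * pi * (n%:R / q%:R) : R) != 1.
    move=> /andP[n0 nq]; apply: cis_neq1.
    have pi0 := pi_gt0 R.
    have tpi : 0 < 2 * pi :> R by lra.
    have nq0 : 0 < n%:R / q%:R :> R by rewrite divr_gt0 // ltr0n.
    rewrite (mulr_gt0 tpi nq0) /= (gtr_pMr _ tpi).
    by rewrite ltr_pdivrMr// mul1r ltr_nat.
  (* Negative [d] reduces to the positive case by conjugation. *)
  rewrite /w; case: (d) d0 dq => n; first by move=> n0 nq; apply: H; apply/andP.
  rewrite NegzE abszN => n0 nq; apply: contraNneq (H n.+1 _) => [/(congr1 conjc)|].
    by rewrite rmorphN mulNr mulrN -conjc_cis conjcK conjc1 => ->.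
  by apply/andP.
under eq_bigr do rewrite mulrA mulr_natr cisMn.
have := subrX1 w q; rewrite wq subrr => /esym/eqP.
by rewrite mulf_eq0 subr_eq0 (negbTE w1) => /eqP.
Qed.

(* [\prod_i {0, ..., c i - 1}], meaningful when [M] bounds every [c i]. *)
Definition box {m : nat} (M : nat) (c : 'I_m -> nat) : {set {ffun 'I_m -> 'I_M}} :=
  [set f : {ffun 'I_m -> 'I_M} | [forall i, (f i < c i)%N]].

Lemma in_box (m M : nat) (c : 'I_m -> nat) (f : {ffun 'I_m -> 'I_M}) :
  (f \in box M c) = (f \in family (fun i => [pred j : 'I_M | (j < c i)%N])).
Proof. by rewrite inE; apply/forallP/familyP. Qed.

Lemma card_box (m M : nat) (c : 'I_m -> nat) : (forall i, (c i <= M)%N) ->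
  #|box M c| = (\prod_i c i)%N.
Proof.
move=> cM.
rewrite (eq_card (@in_box _ _ _)) card_family foldrE big_image /=; apply: eq_bigr => i _.
by rewrite -sum1_card (big_ord_narrow (cM i)) sum1_card card_ord.
Qed.

(** The sum factors over the coordinates, and one vanishing factor suffices. *)
Lemma sum_box_cis (R : realType) (m M : nat) (q : 'I_m -> nat) (d : 'I_m -> int) :
    (forall i, (q i <= M)%N) -> (exists i, (0 < `|d i| < q i)%N) ->
  \sum_(j in box M q) cis (2 * pi * \sum_i (d i)%:~R / (q i)%:R * (j i)%:R : R) = 0.
Proof.
move=> qM [i di].
under eq_bigr do rewrite mulr_sumr cis_sum.
rewrite (eq_bigl _ _ (@in_box _ _ _)).
rewrite -(bigA_distr_big_dep (fun i => [pred j : 'I_M | (j < q i)%N])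
  (fun i (j : 'I_M) => cis (2 * pi * ((d i)%:~R / (q i)%:R * j%:R) : R))).
by rewrite (bigD1 i) //= (big_ord_narrow (qM i)) sum_cis0 // mul0r.
Qed.

(** * Sampling a trigonometric polynomial with integer frequencies *)

Definition ntrig_poly {R : realType} {n : nat} (p : 'I_n -> nat)
    (ca cb : 'I_n -> R) (y : R) : R :=
  \sum_(k < n) (ca k * cos (2 * pi * (p k)%:R * y)
               + cb k * sin (2 * pi * (p k)%:R * y)).

(** Along these shifts a wave of integer frequency [p] restricts to the character of the product of
    the Z/q_i given by [p] modulo each [q i]. *)
Definition box_shift {R : realType} {m M : nat} (q : 'I_m -> nat)
    (j : {ffun 'I_m -> 'I_M}) : R :=
  \sum_i (j i)%:R / (q i)%:R.

Lemma real_trigE (R : realType) (a b t : R) :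
  (a * cos t + b * sin t)%:C =
  ((a / 2) -i* (b / 2)) * cis t + ((a / 2) +i* (b / 2)) * cis (- t).
Proof.
by rewrite /cis cosN sinN; simpc; congr (_ +i* _); field; rewrite ?pnatr_eq0.
Qed.

(* The factors [1%:~R] and [(- 1)%:~R] present both halves as integer frequencies
   [s * p k] with [s = 1] or [s = -1], so that they are treated uniformly. *)
Lemma ntrig_polyE (R : realType) (n : nat) (p : 'I_n -> nat)
    (ca cb : 'I_n -> R) (y : R) :
  (ntrig_poly p ca cb y)%:C = \sum_(k < n)
    (((ca k / 2) -i* (cb k / 2)) * cis (2 * pi * (1%:~R * (p k)%:R) * y) +
     ((ca k / 2) +i* (cb k / 2)) * cis (2 * pi * ((- 1)%:~R * (p k)%:R) * y)).
Proof.
rewrite rmorph_sum; apply: eq_bigr => k _.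
by rewrite [LHS]real_trigE mul1r mulN1r mulrN mulNr.
Qed.

(** This is why the modulus is [A + B]: moving a frequency [p] or [-p] by a difference of absolute
    value less than [A] neither reaches 0 nor attains absolute value [A + B], so the result is
    nonzero modulo [A + B]. *)
Lemma absz_shift_bound (A B p k l : nat) (s : int) :
    `|s|%N = 1%N -> (A <= p <= B)%N -> (k < A)%N -> (l < A)%N ->
  (0 < `|(s * p%:Z + (k%:Z - l%:Z))%R| < A + B)%N.
Proof.
move=> s1 ? ? ?; have [->|->] : s = 1 \/ s = -1 by lia.
  lia.
lia.
Qed.

Lemma box_positives (R : realType) (m M n : nat) (A B : 'I_m -> nat)
    (p : 'I_n -> nat) (ca cb : 'I_n -> R) (y : R) :
    let q i := (A i + B i)%N in
    (forall i, 0 < B i)%N -> (forall i, q i <= M)%N ->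
    (forall k, exists i, A i <= p k <= B i)%N ->
    {in box M q, forall j, ntrig_poly p ca cb (y + box_shift q j) != 0} ->
  (\prod_i A i <=
     #|[set j in box M q | (0 < ntrig_poly p ca cb (y + box_shift q j))%R]|)%N.
Proof.
move=> q B0 qM pAB F0.
have q0 i : (0 < q i)%N by rewrite addn_gt0 B0 orbT.
have AM i : (A i <= M)%N by rewrite (leq_trans _ (qM i)) ?leq_addr.
rewrite -(card_box _ _ _ AM).
pose phi (k j : {ffun 'I_m -> 'I_M}) : R[i] :=
  cis (2 * pi * \sum_i (k i)%:~R / (q i)%:R * (j i)%:R).
have phiE (k l j : {ffun 'I_m -> 'I_M}) : phi k j * (phi l j)^*%C =
    cis (2 * pi * \sum_i ((k i)%:Z - (l i)%:Z)%:~R / (q i)%:R * (j i)%:R).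
  rewrite /phi conjc_cis -cisD -mulrN -mulrDr -sumrN -big_split /=.
  by congr (cis (_ * _)); apply: eq_bigr => i _; rewrite rmorphB /=; ring.
apply: (isotropic_card _ _ _ _ _ _ phi #|box M q|%:R _ F0).
- by rewrite card_box // pnatr_eq0 -lt0n prodn_gt0.
- move=> k l kA lA.
  under eq_bigr do rewrite ntrig_polyE mulr_suml.
  rewrite exchange_big big1 // => t _.
  (* Only a coordinate [i] whose interval contains the frequency is needed: the character sum
     already vanishes there. *)
  have [i /andP[ptA ptB]] := pAB t.
  have cis_shift (s : int) j : cis (2 * pi * (s%:~R * (p t)%:R) * (y + box_shift q j)) *
      (phi k j * (phi l j)^*%C) = cis (2 * pi * (s%:~R * (p t)%:R) * y) *
    cis (2 * pi * \sum_i
      (s * (p t)%:Z + ((k i)%:Z - (l i)%:Z))%:~R / (q i)%:R * (j i)%:R).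
    rewrite phiE -!cisD; congr cis; rewrite mulrDr -addrA; congr (_ + _).
    rewrite -mulrA -mulrDr; congr (_ * _).
    rewrite mulr_sumr -big_split /=; apply: eq_bigr => h _.
    by rewrite !intrD intrM; ring.
  have sum_s (s : int) : `|s|%N = 1%N ->
      \sum_(j in box M q) cis (2 * pi * (s%:~R * (p t)%:R) * (y + box_shift q j)) *
      (phi k j * (phi l j)^*%C) = 0.
    move=> s1; under eq_bigr do rewrite cis_shift.
    rewrite -mulr_sumr sum_box_cis ?mulr0 //; exists i.
    move: kA lA; rewrite !inE => /forallP/(_ i) kA /forallP/(_ i) lA.
    by apply: absz_shift_bound; rewrite ?ptA.
  under eq_bigr do rewrite mulrDl -[X in X + _]mulrA -[X in _ + X]mulrA.
  by rewrite big_split /= -!mulr_sumr !sum_s // !mulr0 addr0.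
- move=> k l kA lA; case: eqP => [->|/eqP kl].
    rewrite -sum1_card natr_sum; apply: eq_bigr => j _.
    rewrite phiE big1 ?mulr0 ?cis0 // => i _.
    by rewrite subrr !mul0r.
  under eq_bigr do rewrite phiE.
  apply: sum_box_cis => //.
  (* Distinct [k] and [l] differ in some coordinate, by less than [A i], hence by less than
     [q i]. *)
  have /existsP[i kli] : [exists i, k i != l i].
    rewrite -negb_forall; apply: contra kl => /forallP H.
    by apply/eqP/ffunP => i; apply/eqP.
  exists i; move: kA lA kli; rewrite !inE => /forallP/(_ i) kA /forallP/(_ i) lA.
  rewrite -val_eqE /= /q; move: (B0 i); lia.
Qed.

Local Open Scope classical_set_scope.

(** * Lebesgue measure: translations, averaging and periodic sets *)

Lemma measurable_shift (R : realType) (t : R) :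
  measurable_fun [set: R] ((fun x => x + t) : R -> measurableTypeR R).
Proof.
by apply: continuous_measurable_fun => x; apply: cvgD; [exact: cvg_id|exact: cvg_cst].
Qed.

Lemma lebesgue_measure_shift (R : realType) (t : R) (A : set R) :
  measurable A -> lebesgue_measure [set x | A (x + t)] = lebesgue_measure A.
Proof.
move=> mA.
change (pushforward (@lebesgue_measure R)
  ((fun x => x + t) : R -> measurableTypeR R) A = lebesgue_measure A).
apply/esym/lebesgue_measure_unique => //=.
  exact: measurable_shift.
move=> mS _ [[a b]] _ <-.
rewrite /pushforward/=.
rewrite (_ : _ @^-1` _ = `]a - t, b - t]%classic); last first.
  apply/seteqP; split => x /=; rewrite in_itv /= => /andP[? ?];
  by rewrite in_itv /=; apply/andP; split; lra.
rewrite !lebesgue_measure_itv /= !lte_fin ltrD2r.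
by case: ifP => // _; rewrite !EFinN -!EFinB; congr (_%:E); ring.
Qed.

(** The count of the [E j] containing [x] is a sum of indicators; integrating the lower bound [K]
    over [D] gives the claim, the exceptional set [N] being negligible. *)
Lemma sum_measure_ge d (T : measurableType d) (R : realType)
    (mu : {measure set T -> \bar R}) (D N : set T) (I : finType) (J : {set I})
    (E : I -> set T) (K : nat) :
    measurable D -> (forall j, measurable (E j)) -> mu.-negligible N ->
    (forall x, D x -> ~ N x -> (K <= #|[set j in J | x \in E j]%SET|)%N) ->
  (K%:R%:E * mu D <= \sum_(j in J) mu (E j `&` D))%E.
Proof.
move=> mD mE N0 KE.
rewrite -(integral_cst mu mD).
under eq_bigr => j _ do rewrite -(integral_indic _ mD (mE j)).
have mind j : measurable_fun D (fun x => (\1_(E j) x)%:E : \bar R).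
  by apply/measurable_EFinP; exact: measurable_indic.
have ind0 j x : (0 <= (\1_(E j) x)%:E :> \bar R)%E by rewrite lee_fin.
rewrite -big_enum -ge0_integral_sum//.
apply: ae_ge0_le_integral => //.
- by move=> x _; rewrite lee_fin.
- by move=> x _; rewrite sume_ge0.
- exact: emeasurable_sum.
apply: (negligibleS _ N0) => x /= /not_implyP[Dx]; apply: contra_notP => nNx.
rewrite big_enum sumEFin lee_fin.
apply: (le_trans (_ : _ <= #|[set j in J | x \in E j]%SET|%:R)).
  by rewrite ler_nat; exact: KE.
rewrite -sum1_card natr_sum big_mkcond [leRHS]big_mkcond /=.
by apply: ler_sum => j _; rewrite inE indicE; case: (j \in J) => //=; case: (x \in E j).
Qed.

Lemma periodic_int (R : zmodType) (T : Type) (A : R -> T) (P : R) :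
  (forall x, A (x + P) = A x) -> forall (k : int) x, A (x + P *~ k) = A x.
Proof.
move=> AP.
have H (n : nat) x : A (x + P *+ n) = A x.
  by elim: n x => [|n IH] x; rewrite ?mulr0n ?addr0// mulrSr addrA AP.
case=> n x; first exact: H.
by rewrite NegzE mulrNz -[in RHS](subrK (P *+ n.+1) x) H.
Qed.

(** After reducing [s] modulo [P] to [r], the window becomes []r, r + P]]. It is cut at [P], and the
    overhang []P, r + P]] is moved back by one period to []0, r]]. Half-open intervals keep the
    pieces disjoint. *)
Lemma periodic_measure_shift (R : realType) (A : set R) (P : R) :
    0 < P -> measurable A -> (forall x, A (x + P) = A x) ->
  forall s, lebesgue_measure [set x | 0 < x <= P /\ A (x + s)] =
    lebesgue_measure [set x | 0 < x <= P /\ A x].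
Proof.
move=> P0 mA AP s.
pose r := s - P *~ Num.floor (s / P).
have rP : 0 <= r < P.
  have /andP[] := floor_itv (s / P).
  rewrite ler_pdivlMr// ltr_pdivrMr// intrD mulrDl mul1r => fs sf.
  by rewrite /r -mulrzl; apply/andP; split; lra.
have -> : [set x | 0 < x <= P /\ A (x + s)] = [set x | 0 < x <= P /\ A (x + r)].
  apply/seteqP; split => x [xP Ax]; split => //; move: Ax.
    by rewrite -(periodic_int _ _ _ _ AP (Num.floor (s / P)) (x + r)) -addrA subrK.
  by rewrite -(periodic_int _ _ _ _ AP (Num.floor (s / P)) (x + r)) -addrA subrK.
have -> : [set x | 0 < x <= P /\ A (x + r)] =
    [set x | (A `&` `]r, r + P]%classic) (x + r)].
  apply/seteqP; split => x /=; rewrite in_itv /=.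
    by case=> /andP[? ?] ?; split=> //; apply/andP; split; lra.
  by case=> ? /andP[? ?]; split=> //; apply/andP; split; lra.
have mI a b : measurable (A `&` `]a, b]%classic) by exact: measurableI.
rewrite lebesgue_measure_shift //.
have -> : A `&` `]r, r + P]%classic =
    (A `&` `]r, P]%classic) `|` (A `&` `]P, r + P]%classic).
  rewrite -setIUr; congr (_ `&` _); apply/seteqP; split => x /=; rewrite !in_itv /=.
    by move=> /andP[? ?]; case: (leP x P) => ?; [left|right]; apply/andP; split; lra.
  by case=> /andP[? ?]; apply/andP; split; lra.
have -> : [set x | 0 < x <= P /\ A x] =
    (A `&` `]0, r]%classic) `|` (A `&` `]r, P]%classic).
  rewrite -setIUr; apply/seteqP; split => x /=; rewrite !in_itv /=.
    by move=> [/andP[? ?] ?]; split=> //;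
      case: (leP x r) => ?; [left|right]; apply/andP; split; lra.
  by move=> [? [] /andP[? ?]]; split=> //; apply/andP; split; lra.
have disj a b c : [set x | A x /\ a < x <= b] `&` [set x | A x /\ b < x <= c] = set0.
  by apply/seteqP; split => x //= [[_ /andP[? ?]] [_ /andP[? ?]]]; lra.
have itvE a b : A `&` `]a, b]%classic = [set x | A x /\ a < x <= b].
  by apply/seteqP; split => x /=; rewrite in_itv.
rewrite !measureU;
  [|exact: mI|exact: mI|by rewrite !itvE disj|exact: mI|exact: mI|by rewrite !itvE disj].
rewrite addeC; congr (_ + _)%E.
change (lebesgue_measure (A `&` `]P, r + P]%classic) =
  lebesgue_measure (A `&` `]0, r]%classic)).
rewrite -(lebesgue_measure_shift _ P (A `&` `]P, r + P]%classic)) //;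
  congr lebesgue_measure.
apply/seteqP; split => x /=; rewrite AP !in_itv /= => -[? /andP[? ?]];
  by split=> //; apply/andP; split; lra.
Qed.

(** * Countability of the zero set and measurability *)

(** Cosine is injective on each interval of length [pi] starting at a multiple of [pi], so the index
    [k x] of that interval determines [x] within the fiber. *)
Lemma countable_cos_fiber (R : realType) (c : R) : countable [set x | cos x = c].
Proof.
have pi0 := pi_gt0 R.
pose k (x : R) := Num.floor (x / pi).
have cosk x : cos (x - pi *~ k x) = cos x * (-1) ^ k x.
  have H (n : nat) y : cos (y + pi *+ n) = (-1) ^+ n * cos y.
    exact/alternatingn/cosDpi.
  case: (k x) => n.
    rewrite -[in RHS](subrK (pi *+ n) x) H mulrAC -exprMn mulN1r opprK expr1n.
    by rewrite mul1r.
  by rewrite NegzE mulrNz opprK H mulrC -exprnN -[in RHS]exprVn invrN1.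
have kP x : 0 <= x - pi *~ k x <= pi.
  have /andP[] := floor_itv (x / pi).
  rewrite ler_pdivlMr// ltr_pdivrMr// intrD mulrDl mul1r => fs sf.
  by rewrite -mulrzl; apply/andP; split; lra.
apply/countable_injP; exists (pickle \o k) => x y.
rewrite !inE /= => xc yc /(pcan_inj pickleK) kxy.
have /cos_inj : cos (x - pi *~ k x) = cos (y - pi *~ k y).
  by rewrite !cosk xc yc kxy.
by rewrite !in_itv /= !kP kxy => /(_ isT isT)/(addIr _).
Qed.

(* [cis (2 pi y) ^ N * F y] is a polynomial in [cis (2 pi y)]. *)
Lemma countable_ntrig_poly_zeros (R : realType) (n : nat) (p : 'I_n -> nat)
    (ca cb : 'I_n -> R) (y0 : R) : ntrig_poly p ca cb y0 != 0 ->
  countable [set y | ntrig_poly p ca cb y = 0].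
Proof.
move=> F0.
(* The largest frequency: multiplying by this power clears all negative exponents. *)
pose N := (\max_k p k)%N.
pose g k : R[i] := (ca k / 2) -i* (cb k / 2).
pose g' k : R[i] := (ca k / 2) +i* (cb k / 2).
pose Q : {poly R[i]} :=
  \sum_k (g k *: 'X^(N + p k) + g' k *: 'X^(N - p k)).
have QE y : Q.[cis (2 * pi * y)] =
    cis (2 * pi * y) ^+ N * (ntrig_poly p ca cb y)%:C.
  rewrite ntrig_polyE mulr_sumr horner_sum; apply: eq_bigr => k _.
  rewrite hornerD !hornerZ !hornerXn.
  have -> : cis (2 * pi * (1%:~R * (p k)%:R) * y) = cis (2 * pi * y) ^+ (p k) :> R[i].
    by rewrite -cisMn; congr cis; rewrite -[RHS]mulr_natr mul1r mulrAC.
  have -> : cis (2 * pi * y) ^+ N * (g k * cis (2 * pi * y) ^+ p k +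
     g' k * cis (2 * pi * ((-1)%:~R * (p k)%:R) * y)) =
     g k * cis (2 * pi * y) ^+ (N + p k) +
     g' k * (cis (2 * pi * y) ^+ N * cis (2 * pi * ((-1)%:~R * (p k)%:R) * y)).
    by rewrite exprD; ring.
  congr (_ + _ * _).
  have pN : (p k <= N)%N by exact: leq_bigmax.
  rewrite -!cisMn -cisD; congr cis.
  by rewrite -[LHS]mulr_natr -[X in X + _]mulr_natr natrB //; ring.
have cis_neq0 (t : R) : cis t != 0.
  apply/eqP => ct; have := cisD _ t (- t).
  by rewrite subrr cis0 ct mul0r => /eqP; rewrite oner_eq0.
have Q0 : Q != 0.
  apply: contraNneq F0 => Q0; have := QE y0; rewrite Q0 horner0 => /esym/eqP.
  rewrite mulf_eq0 expf_eq0 (negbTE (cis_neq0 _)) andbF /=.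
  by rewrite (inj_eq (@complexI _) _ 0).
have [s sP] : exists s : seq R[i], forall z, root Q z -> z \in s.
  have [s Qs] := closed_field_poly_normal Q.
  exists s => z; rewrite Qs rootZ ?lead_coef_eq0 //.
  by rewrite root_prod_XsubC.
have pi0 := pi_gt0 R.
(* A zero [y] makes [cis (2 * pi * y)] one of finitely many roots; comparing real parts reduces the
   claim to fibers of cosine. *)
have sub : [set y | ntrig_poly p ca cb y = 0] `<=`
    \bigcup_(z in [set` s]) [set y : R | cos (2 * pi * y) = complex.Re z].
  move=> y /= Fy; exists (cis (2 * pi * y)) => //=.
  by apply: sP; rewrite /root QE Fy mulr0.
apply: (sub_countable (subset_card_le sub)).
apply: bigcup_countable; first exact/finite_set_countable.
move=> z _; have /countable_injP[f fi] := countable_cos_fiber _ (complex.Re z).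
apply/countable_injP; exists (f \o (fun y => 2 * pi * y)) => x y.
rewrite !inE /= => xz yz /fi; rewrite !inE => /(_ xz yz) /mulfI; apply.
by apply: lt0r_neq0; lra.
Qed.

Lemma measurable_ntrig_poly (R : realType) (n : nat) (p : 'I_n -> nat)
    (ca cb : 'I_n -> R) :
  measurable_fun [set: R] (ntrig_poly p ca cb : R -> R).
Proof.
apply: measurable_sum => k.
have ml : measurable_fun [set: R] (fun y : R => 2 * pi * (p k)%:R * y).
  by apply: continuous_measurable_fun; exact: mulrl_continuous.
apply: measurable_funD; apply: measurable_funM => //.
  exact: (measurableT_comp (continuous_measurable_fun (@continuous_cos R)) ml).
exact: (measurableT_comp (continuous_measurable_fun (@continuous_sin R)) ml).
Qed.

(** * Averaging the sample count over a period *)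

Lemma positivity_measure_ge (R : realType) (m n : nat) (A B : 'I_m -> nat)
    (p : 'I_n -> nat) (ca cb : 'I_n -> R) (D P : R) :
    let F x := ntrig_poly p ca cb (x / D) in
    0 < D -> 0 < P -> (forall i, 0 < B i)%N ->
    (forall k, exists i, A i <= p k <= B i)%N ->
    (exists x, F x != 0) -> (forall x, F (x + P) = F x) ->
  \prod_i ((A i)%:R / (A i + B i)%:R) <= rho_plus F P.
Proof.
move=> F D0 P0 B0 pAB [x0 Fx0] FP.
pose q i := (A i + B i)%N.
pose M := (\max_i q i)%N.
have qM i : (q i <= M)%N by exact: (leq_bigmax i).
have mF : measurable_fun [set: R] F.
  apply: (measurableT_comp (measurable_ntrig_poly _ _ p ca cb)).
  by apply: continuous_measurable_fun; exact: mulrr_continuous.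
pose S := [set x | 0 < F x].
have mS : measurable S.
  rewrite (_ : S = [set: R] `&` F @^-1` `]0, +oo[%classic).
    exact: mF.
  by rewrite setTI; apply/seteqP; split => x /=; rewrite in_itv /= andbT.
have SP x : S (x + P) = S x by rewrite /S /= FP.
(* The factor [D] compensates for [F] being evaluated at [x / D]. *)
pose s (j : {ffun 'I_m -> 'I_M}) : R := D * box_shift q j.
have Fs x j : F (x + s j) = ntrig_poly p ca cb (x / D + box_shift q j).
  by rewrite /F /s mulrDl; congr (ntrig_poly _ _ _ (_ + _)); field; rewrite gt_eqF.
pose E j := [set x | S (x + s j)].
have mE j : measurable (E j).
  rewrite (_ : E j = [set: R] `&` (fun x => x + s j) @^-1` S) ?setTI//.
  by rewrite -[X in measurable X]setTI; exact: measurable_shift.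
pose Z := \bigcup_(j in [set: {ffun 'I_m -> 'I_M}]) [set x | F (x + s j) = 0].
have Z0 : (@lebesgue_measure R).-negligible Z.
  have cZ : countable Z.
    apply: bigcup_countable => [|j _]; first exact: countableP.
    have /countable_injP[f fi] := countable_ntrig_poly_zeros _ _ p ca cb _ Fx0.
    apply/countable_injP; exists (fun x => f (x / D + box_shift q j)) => x y.
    rewrite !inE /= !Fs => Fx Fy /fi; rewrite !inE /= => /(_ Fx Fy) /addIr.
    by apply: mulIf; rewrite invr_eq0 gt_eqF.
  exists Z; split => //; first exact: countable_measurable.
  exact: countable_lebesgue_measure0.
pose I : set R := `]0, P]%classic.
have mI : measurable I by exact: measurable_itv.
have KE x : I x -> ~ Z x ->
    (\prod_i A i <= #|[set j in box M q | x \in E j]%SET|)%N.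
  move=> _ nZ.
  have F0 : {in box M q, forall j,
      ntrig_poly p ca cb (x / D + box_shift q j) != 0}.
    by move=> j _; apply/eqP => Fj; apply: nZ; exists j => //=; rewrite Fs.
  apply: (leq_trans (box_positives _ _ _ _ _ _ _ _ _ _ B0 qM pAB F0)).
  apply: subset_leq_card; apply/fintype.subsetP => j; rewrite !inE => /andP[-> Fj] /=.
  by rewrite inE /E /S /= Fs.
(* By periodicity every sample is positive on a set of the same measure, so the sum over [j] becomes
   a multiple of one measure. *)
have EI j : lebesgue_measure (E j `&` I) = lebesgue_measure (S `&` I).
  rewrite (_ : E j `&` I = [set x | 0 < x <= P /\ S (x + s j)]).
    rewrite (periodic_measure_shift _ _ _ P0 mS SP); congr lebesgue_measure.
    by apply/seteqP; split => x /= []; rewrite /I /= in_itv.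
  by apply/seteqP; split => x /= []; rewrite /I /= in_itv.
pose T := [set x : R | 0 <= x <= P /\ 0 < F x].
have mT : measurable T.
  rewrite (_ : T = `[0, P]%classic `&` S).
    by apply: measurableI => //; exact: measurable_itv.
  by apply/seteqP; split => x /= []; rewrite in_itv.
have SI : (lebesgue_measure (S `&` I) <= lebesgue_measure T)%E.
  apply: le_measure; rewrite ?inE//; first exact: measurableI.
  move=> x [Sx]; rewrite /I /= in_itv /= => /andP[x0' xP].
  by split=> //; rewrite (ltW x0').
have muI : lebesgue_measure I = P%:E :> \bar R.
  by rewrite lebesgue_measure_itv /= lte_fin P0 -EFinB subr0.
(* Finiteness ensures that [fine] in [rho_plus] preserves the inequality. *)
have fT : lebesgue_measure T \is a fin_num.
  rewrite ge0_fin_numE ?measure_ge0//; apply: (@le_lt_trans _ _ P%:E); last exact: ltry.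
  rewrite -(_ : lebesgue_measure `[0, P]%classic = P%:E); last first.
    by rewrite lebesgue_measure_itv /= lte_fin P0 -EFinB subr0.
  apply: le_measure; [by rewrite inE | by rewrite inE; exact: measurable_itv|].
  by move=> x [xP _]; rewrite /= in_itv.
have : ((\prod_i A i)%N%:R%:E * P%:E <=
    \sum_(j in box M q) lebesgue_measure (S `&` I))%E.
  rewrite -muI -(eq_bigr _ (fun j _ => EI j)).
  exact: (sum_measure_ge _ _ _ (@lebesgue_measure R) I Z _ _ E _ mI mE Z0 KE).
have fS : lebesgue_measure (S `&` I) \is a fin_num.
  rewrite ge0_fin_numE ?measure_ge0//; apply: le_lt_trans SI _.
  by rewrite -ge0_fin_numE ?measure_ge0.
rewrite -(fineK fS) sumEFin -EFinM lee_fin sumr_const card_box // -[leRHS]mulr_natl => H.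
have {}H := le_trans H (ler_wpM2l (ler0n _ _) (fine_le fS fT SI)).
have -> : \prod_i ((A i)%:R / (A i + B i)%:R) =
    (\prod_i A i)%N%:R / (\prod_i q i)%N%:R :> R.
  by rewrite !natr_prod -prodf_div.
have q0 : 0 < (\prod_i q i)%N%:R :> R.
  by rewrite ltr0n prodn_gt0 // => i; rewrite addn_gt0 B0 orbT.
rewrite /rho_plus ler_pdivlMr // mulrAC ler_pdivrMr //.
by rewrite [leRHS]mulrC.
Qed.

(** * Reduction from rational to integer frequencies *)

Lemma common_denominator (R : realType) (n : nat) (th : 'I_n -> rat) :
    (forall k, 0 < th k) ->
  exists D : nat, (0 < D)%N /\ exists p : 'I_n -> nat,
    forall k, (0 < p k)%N /\ ratr (th k) = (p k)%:R / D%:R :> R.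
Proof.
move=> th0; pose d k := `|denq (th k)|%N.
have d0 k : (0 < d k)%N by rewrite absz_gt0 denq_neq0.
exists (\prod_k d k)%N; split; first exact: prodn_gt0.
exists (fun k => `|numq (th k)| * \prod_(j | j != k) d j)%N => k; split.
  by rewrite muln_gt0 absz_gt0 numq_eq0 gt_eqF //= prodn_cond_gt0.
rewrite /ratr [X in _ / X%:R](bigD1 k) //= !natrM -mulf_div divff ?mulr1; last first.
  by rewrite pnatr_eq0 -lt0n prodn_cond_gt0.
rewrite !natr_absz !ger0_norm ?denq_ge0//.
by rewrite numq_ge0 ltW.
Qed.

(** Since a / (a + b) grows with a and decreases with b, shrinking the interval to the extreme
    frequencies it contains can only improve the factor; the scale [D] cancels. *)
Lemma integer_endpoints (R : realType) (n : nat) (p : 'I_n -> nat) (D a b : R) :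
    0 < D -> 0 < a <= b -> (forall k, 0 < p k)%N ->
  exists AB : nat * nat, [/\ (0 < AB.2)%N,
    forall k, a <= (p k)%:R / D <= b -> (AB.1 <= p k <= AB.2)%N &
    1 / (1 + b / a) <= AB.1%:R / (AB.1 + AB.2)%:R].
Proof.
move=> D0 /andP[a0 ab] p0.
have b0 : 0 < b by exact: lt_le_trans ab.
have -> : 1 / (1 + b / a) = a / (a + b).
  by field; rewrite !gt_eqF ?addr_gt0.
pose Q k := a <= (p k)%:R / D <= b.
have [[k0 Qk0]|noQ] := pselect (exists k, Q k); last first.
  (* No frequency lies in [a, b]: the factor 1/2 is at least a / (a + b). *)
  exists (1, 1)%N; split => //= [k Qk|]; first by case: noQ; exists k.
  rewrite ler_pdivrMr ?addr_gt0// mulrAC ler_pdivlMr ?ltr0n//.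
  lra.
case: (arg_minnP p Qk0) => k1 /andP[ak1 _] k1min.
case: (arg_maxnP p Qk0) => k2 /andP[_ bk2] k2max.
exists (p k1, p k2); split => //= [k Qk|].
  by rewrite k1min //; exact: k2max.
have q1 : 0 < (p k1)%:R :> R by rewrite ltr0n.
have q2 : 0 < (p k2)%:R :> R by rewrite ltr0n.
move: ak1 bk2; rewrite ler_pdivlMr // ler_pdivrMr // => ak1 bk2.
rewrite natrD ler_pdivrMr ?addr_gt0// mulrAC ler_pdivlMr ?addr_gt0//.
rewrite !mulrDr [in leRHS]mulrC lerD2l.
(* With common terms cancelled, [a * p k2 <= p k1 * b] remains; it follows from [p k2 <= b * D] and
   [a * D <= p k1]. *)
apply: (@le_trans _ _ (a * (b * D))); first by rewrite ler_pM2l.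
by rewrite mulrCA mulrC ler_pM2r.
Qed.

(** * The bound for rational frequencies and both signs *)

Lemma rho_plus_ge (R : realType) (n : nat) (th : 'I_n -> rat)
  (ca cb : 'I_n -> R) (m : nat) (a b : 'I_m -> R) (P : R) :
  (forall k, 0 < th k) ->
  (forall i, 0 < a i /\ a i <= b i) ->
  (forall k, exists i, a i <= ratr (th k) <= b i) ->
  (exists x, trig_poly th ca cb x != 0) ->
  0 < P ->
  (forall x, trig_poly th ca cb (x + P) = trig_poly th ca cb x) ->
  \prod_(i < m) (1 / (1 + b i / a i)) <= rho_plus (trig_poly th ca cb) P.
Proof.
move=> th0 ab0 thab F0 P0 FP.
have [D [D0 [p pD]]] := common_denominator R _ _ th0.
have D0' : 0 < D%:R :> R by rewrite ltr0n.
have /choice[AB ABP] i : exists AB : nat * nat, [/\ (0 < AB.2)%N,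
    forall k, a i <= (p k)%:R / D%:R <= b i -> (AB.1 <= p k <= AB.2)%N &
    1 / (1 + b i / a i) <= AB.1%:R / (AB.1 + AB.2)%:R].
  apply: integer_endpoints => //; first exact/andP/ab0.
  by move=> k; have [] := pD k.
have FE : trig_poly th ca cb = fun x => ntrig_poly p ca cb (x / D%:R).
  apply/funext => x; apply: eq_bigr => k _; have [_ ->] := pD k.
  by congr (_ * cos _ + _ * sin _); ring.
rewrite FE in F0 FP *.
apply: le_trans (positivity_measure_ge _ _ _ (fun i => (AB i).1)
  (fun i => (AB i).2) _ _ _ _ _ D0' P0 _ _ F0 FP).
- apply: ler_prod => i _; have [a0 ab] := ab0 i; have [_ _ ->] := ABP i.
  by rewrite divr_ge0 // addr_ge0 // divr_ge0 // ltW // (lt_le_trans a0).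
- by move=> i; have [] := ABP i.
- move=> k; have [i thi] := thab k; exists i; have [_ + _] := ABP i; apply.
  by have [_ <-] := pD k.
Qed.

Theorem theorem3 (R : realType) (n : nat) (th : 'I_n -> rat)
  (ca cb : 'I_n -> R) (m : nat) (a b : 'I_m -> R) (P : R) :
  injective th ->
  (forall k, 0 < th k) ->
  (forall i, 0 < a i /\ a i <= b i) ->
  (forall k, exists i, a i <= ratr (th k) <= b i) ->
  (exists x, trig_poly th ca cb x != 0) ->
  0 < P ->
  (forall x, trig_poly th ca cb (x + P) = trig_poly th ca cb x) ->
  \prod_(i < m) (1 / (1 + b i / a i)) <=
    Num.min (rho_plus (trig_poly th ca cb) P) (rho_minus (trig_poly th ca cb) P).
Proof.
move=> _ th0 ab0 thab [x0 Fx0] P0 FP.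
(* Negating the coefficients negates the function, which turns the bound for [rho_plus] into one for
   [rho_minus]. *)
have FN x : trig_poly th (fun k => - ca k) (fun k => - cb k) x =
    - trig_poly th ca cb x.
  by rewrite -sumrN; apply: eq_bigr => k _; rewrite !mulNr -opprD.
rewrite le_min rho_plus_ge //; last by exists x0.
have -> : rho_minus (trig_poly th ca cb) P =
    rho_plus (trig_poly th (fun k => - ca k) (fun k => - cb k)) P.
  rewrite /rho_minus /rho_plus; congr (fine (lebesgue_measure _) / _).
  by apply/seteqP; split => x /=; rewrite FN oppr_gt0.
apply: rho_plus_ge => // [|x]; first by exists x0; rewrite FN oppr_eq0.
by rewrite !FN FP.
Qed.
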